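(* Let $C_{(\geq,\neq)}(x,y)$ be the bivariate generating function of the Catalan words avoiding the ordered pair of relations $(\geq,\neq)$, where $x$ marks the length and $y$ marks the number of descents. Then $$C_{(\geq,\neq)}(x,y)=\frac {1-2x+2x^2-x^3+x^3y}{\left( 1-x \right) ^{3}}.$$
   Context: A Catalan word of length $n$ is a word $w=w_1w_2\cdots w_n$ over the non-negative integers with $w_1=0$ and $0\leq w_i\leq w_{i-1}+1$ for $i=2,\dots,n$; the empty word is the unique Catalan word of length $0$. For relations $X,Y\in\{<,>,\leq,\geq,=,\neq\}$, a word $w$ contains the pattern $(X,Y)$ if there is an index $i\geq 1$ (with $i+2\le n$) such that $w_i\,X\,w_{i+1}$ and $w_{i+1}\,Y\,w_{i+2}$; otherwise $w$ avoids $(X,Y)$. The number of descents $\mathrm{des}(w)$ is the number of indices $i$ with $w_i>w_{i+1}$. The bivariate generating function is $C_{(X,Y)}(x,y)=\sum_{w}x^{|w|}y^{\mathrm{des}(w)}$, the sum being over all Catalan words $w$ (of any length $|w|\geq 0$) avoiding $(X,Y)$. Identities are between formal power series in $x$ with coefficients polynomials in $y$. *)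

(* Defs.v *)
From mathcomp Require Import all_boot all_order all_algebra.

Set Implicit Arguments.
Unset Strict Implicit.
Unset Printing Implicit Defensive.

Import GRing.Theory.
Local Open Scope ring_scope.

(* Words are 0-indexed: the letter w_(i+1) is [nth 0%N w i]. *)

Definition catalan (w : seq nat) : bool :=
  (head 0 w == 0)%N && sorted (fun a b => b <= a.+1)%N w.

Definition contains (X Y : rel nat) (w : seq nat) : bool :=
  [exists i : 'I_(size w - 2),
    X (nth 0%N w i) (nth 0%N w i.+1) && Y (nth 0%N w i.+1) (nth 0%N w i.+2)].

Definition avoids (X Y : rel nat) (w : seq nat) : bool := ~~ contains X Y w.

Definition des (w : seq nat) : nat :=
  #|[set i : 'I_(size w - 1) | (nth 0 w i > nth 0 w i.+1)%N]|.

Definition neqn : rel nat := fun a b => a != b.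

Definition fps (R : Type) : Type := nat -> R.

Definition fps_mul (R : comUnitRingType) (f g : fps R) : fps R :=
  fun n => \sum_(i < n.+1) f i * g (n - i)%N.

Definition fps_of_poly (R : comUnitRingType) (p : {poly R}) : fps R :=
  fun n => p`_n.

(* First n coefficients of f / g, found by solving h * g = f degree by degree;
   meaningful when g 0 is a unit (see fps_div_unique). *)
Fixpoint fps_div_coefs (R : comUnitRingType) (f g : fps R) (n : nat) : seq R :=
  if n is m.+1 then
    let s := fps_div_coefs f g m in
    rcons s ((f m - \sum_(i < m) s`_i * g (m - i)%N) / g 0%N)
  else [::].

Definition fps_div (R : comUnitRingType) (f g : fps R) : fps R :=
  fun n => (fps_div_coefs f g n.+1)`_n.

(* An element of [fps {poly int}] is a power series in x whose coefficients are
   polynomials in y. The letters of a Catalan word of length n are below n (see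
   catalan_letters), so the sum ranges over all Catalan words of length n. *)
Definition catalan_gf (X Y : rel nat) : fps {poly int} :=
  fun n =>
    \sum_(w : n.-tuple 'I_n |
            catalan (map val w) && avoids X Y (map val w))
      'X^(des (map val w)).

(* Polynomials in x over polynomials in y. *)
Definition x_ : {poly {poly int}} := 'X.
Definition y_ : {poly {poly int}} := 'X%:P.

Lemma size_fps_div_coefs (R : comUnitRingType) (f g : fps R) n :
  size (fps_div_coefs f g n) = n.
Proof. by elim: n => //= n IH; rewrite size_rcons IH. Qed.

Lemma nth_fps_div_coefs (R : comUnitRingType) (f g : fps R) n i :
  (i < n)%N -> (fps_div_coefs f g n)`_i = fps_div f g i.
Proof.
elim: n => // n IH; rewrite ltnS leq_eqVlt => /orP[/eqP -> // | lt_in].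
by rewrite /= nth_rcons size_fps_div_coefs lt_in IH.
Qed.

Lemma fps_divE (R : comUnitRingType) (f g : fps R) n :
  fps_div f g n =
  (f n - \sum_(i < n) fps_div f g i * g (n - i)%N) / g 0%N.
Proof.
rewrite {1}/fps_div /= nth_rcons size_fps_div_coefs ltnn eqxx.
by congr ((_ - _) / _); apply: eq_bigr => i _; rewrite nth_fps_div_coefs.
Qed.

Lemma fps_divK (R : comUnitRingType) (f g : fps R) :
  g 0%N \is a GRing.unit -> fps_mul (fps_div f g) g =1 f.
Proof.
move=> g0 n; rewrite /fps_mul big_ord_recr /= subnn [X in X * _]fps_divE.
by rewrite divrK // addrC subrK.
Qed.

Lemma fps_div_unique (R : comUnitRingType) (f g h : fps R) :
  g 0%N \is a GRing.unit -> fps_mul h g =1 f -> h =1 fps_div f g.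
Proof.
move=> g0 hgf n; elim/ltn_ind: n => n IH.
rewrite fps_divE -hgf /fps_mul big_ord_recr /= subnn.
rewrite -(eq_bigr _ (fun i _ => congr1 ( *%R^~ _) (IH _ (ltn_ord i)))).
by rewrite addrAC subrr add0r mulrK.
Qed.

Lemma fps_of_polyM (R : comUnitRingType) (p q : {poly R}) :
  fps_of_poly (p * q) =1 fps_mul (fps_of_poly p) (fps_of_poly q).
Proof. by move=> n; rewrite /fps_of_poly coefM. Qed.

Lemma catalan_letters (w : seq nat) :
  catalan w -> all (fun a => a < size w)%N w.
Proof.
case: w => // a s /andP[/eqP /= -> ps].
have gen b : path (fun a b => b <= a.+1)%N b s ->
    all (fun c => c <= b + size s)%N s.
  elim: s b {ps} => //= c s IH b /andP[cb /IH cs].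
  rewrite addnS -addSn (leq_trans cb) ?leq_addr //=.
  by apply: sub_all cs => d /leq_trans; apply; rewrite leq_add2r.
exact: (gen 0%N).
Qed.

(* Main.v *)
(* In a Catalan word avoiding (>=, <>) every step after the first weak descent
   is an equality, and before it the letters increase by exactly 1.  Hence the
   words of length n are 0 1 ... n-1 and the words 0 1 ... (k-1) a a ... a with
   a < k < n, which have a descent exactly when a < k - 1.  This gives the
   coefficient n + binomial(n-1, 2) y of x^n for n > 0, and multiplying by
   (1 - x)^3 yields the numerator. *)
Require Import Defs.
From mathcomp Require Import all_boot all_order all_algebra.
From mathcomp Require Import zify ring.

Set Implicit Arguments.
Unset Strict Implicit.
Unset Printing Implicit Defensive.

Import GRing.Theory.
Local Open Scope ring_scope.

Definition ramp (n k a : nat) : seq nat :=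
  mkseq (fun i => if (i < k)%N then i else a) n.

(** The staircase is listed apart, and once: at [k = n] the tail is empty and every [a] would give
    the same word. For [n = 0] only the empty word remains. *)
Definition ramps (n : nat) : seq (seq nat) :=
  ramp n n 0 :: [seq ramp n k a | k <- iota 1 n.-1, a <- iota 0 k].

Lemma size_ramp n k a : size (ramp n k a) = n.
Proof. exact: size_mkseq. Qed.

Lemma nth_ramp n k a i :
  (i < n)%N -> nth 0%N (ramp n k a) i = if (i < k)%N then i else a.
Proof. by move=> lt_in; rewrite nth_mkseq. Qed.

Lemma mem_ramps n w :
  reflect (w = ramp n n 0 \/
           exists k a, [/\ a < k, k < n & w = ramp n k a]%N)
          (w \in ramps n).
Proof.
rewrite inE; apply: (iffP orP) => -[].
- by move/eqP; left.
- case/allpairsPdep=> k [a []]; rewrite !mem_iota => hk ha ->.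
  by right; exists k, a; split=> //; lia.
- by move->; left.
- case=> k [a [lt_ak lt_kn ->]]; right; apply/allpairsPdep; exists k, a.
  by rewrite !mem_iota; split=> //; lia.
Qed.

(** The letters at position [k] differ: [a < k] on one side, [k] on the other. As [k'] has no upper
    bound, the staircase [k' = n] is covered. *)
Lemma ramp_neq n k a k' a' :
  (a < k)%N -> (k < n)%N -> (k < k')%N -> ramp n k a <> ramp n k' a'.
Proof.
move=> lt_ak lt_kn lt_kk' /(congr1 (nth 0%N ^~ k)).
by rewrite !nth_ramp // ltnn lt_kk'; lia.
Qed.

Lemma ramps_uniq n : uniq (ramps n).
Proof.
rewrite /ramps /=; apply/andP; split.
  apply/negP => /allpairsPdep[k [a []]]; rewrite !mem_iota => hk ha /esym.
  by apply: ramp_neq; lia.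
apply: allpairs_uniq_dep => [|k _|]; rewrite ?iota_uniq //.
move=> _ _ /allpairsPdep[k [a [hk ha ->]]] /allpairsPdep[k' [a' [hk' ha' ->]]].
move: hk ha hk' ha'; rewrite !mem_iota /= => hk ha hk' ha' eq_w.
case: (ltngtP k k') => [lt_kk'|lt_k'k|eq_kk'].
- by case: (@ramp_neq n k a k' a'); lia || exact: eq_w.
- by case: (@ramp_neq n k' a' k a); lia || exact: esym eq_w.
- move/(congr1 (nth 0%N ^~ k)): eq_w.
  by rewrite -eq_kk' !nth_ramp ?ltnn; [move-> | lia | lia].
Qed.

Lemma catalanP w :
  reflect (nth 0%N w 0 = 0%N /\
           forall i, (i.+1 < size w -> nth 0 w i.+1 <= (nth 0 w i).+1)%N)
          (catalan w).
Proof.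
rewrite /catalan -nth0.
apply: (iffP andP) => -[h0 hs]; split=> //; try exact/eqP.
- by move/(sortedP 0%N): hs.
- exact/(sortedP 0%N).
Qed.

Lemma avoidsP (X Y : rel nat) w :
  reflect (forall i, (i.+2 < size w)%N ->
             X (nth 0%N w i) (nth 0%N w i.+1) ->
             ~~ Y (nth 0%N w i.+1) (nth 0%N w i.+2))
          (avoids X Y w).
Proof.
rewrite /avoids /contains negb_exists; apply: (iffP forallP) => h i.
- move=> lt_i hX; have lt_i2 : (i < size w - 2)%N by lia.
  by have := h (Ordinal lt_i2); rewrite /= hX.
- have := ltn_ord i => lt_i; rewrite negb_and -implybE.
  by apply/implyP; apply: h; lia.
Qed.

Lemma catalan_avoids_ramps n w :
  (w \in ramps n) = [&& size w == n, catalan w & avoids geq neqn w].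
Proof.
apply/idP/and3P => [w_ramp|[/eqP sz_w /catalanP[w0 wS] /avoidsP w_av]].
  have [k [a [-> cond]]] : exists k a,
      w = ramp n k a /\ (k = n \/ (a < k < n))%N.
    case/mem_ramps: w_ramp => [->|[k [a [lt_ak lt_kn ->]]]].
      by exists n, 0%N; split; [|left].
    by exists k, a; split=> //; right; rewrite lt_ak.
  rewrite size_ramp eqxx; split=> //.
    apply/catalanP; rewrite size_ramp; split=> [|i lt_i].
      by case: n cond {w_ramp} => [|n] cond //; rewrite nth_ramp //; case: ifP; lia.
    by rewrite !nth_ramp //; [do 2![case: ifP]; lia | lia].
  apply/avoidsP; rewrite size_ramp /neqn => i lt_i; rewrite !nth_ramp /=; try lia.
  by do 3![case: ifP]; lia.
apply/mem_ramps.
have [/existsP ex|] := boolP [exists i : 'I_n, nth 0%N w i != i]; last first.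
  rewrite negb_exists => /forallP w_id; left.
  apply: (@eq_from_nth _ 0%N) => [|i]; rewrite ?size_ramp // sz_w => lt_in.
  by rewrite nth_ramp // lt_in; have /= := w_id (Ordinal lt_in); rewrite negbK => /eqP.
(* The least such [k] is where the tail starts; the Catalan bound at [k] then forces the letter
   there below [k]. *)
have exk : exists k, (k < n)%N && (nth 0%N w k != k).
  by case: ex => i wi; exists i; rewrite ltn_ord.
case: (ex_minnP exk) => k /andP[lt_kn wk] min_k.
have w_lt i : (i < k)%N -> nth 0%N w i = i.
  move=> lt_ik; apply/eqP/negPn/negP => wi.
  by have := min_k i; rewrite wi andbT; lia.
have k_gt0 : (0 < k)%N by case: k wk {min_k w_lt lt_kn} => //; rewrite w0.
have lt_wk : (nth 0%N w k < k)%N.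
  by have := wS k.-1; rewrite prednK // sz_w (w_lt k.-1); lia.
(* The weak descent into [k + j] is carried along because, by avoidance, it forces equality at the
   next step, which is again a weak descent. *)
have w_cst j : (k + j < n -> nth 0%N w (k + j) = nth 0%N w k /\
    nth 0%N w (k + j) <= nth 0%N w (k + j).-1)%N.
  elim: j => [|j IH] lt_j; first by rewrite addn0 (w_lt k.-1); lia.
  have [|eq_j le_j] := IH; first by lia.
  have := w_av (k + j).-1; rewrite prednK ?addnS; last by lia.
  rewrite /neqn /geq /= le_j sz_w => /(_ _ isT) h.
  have /h : ((k + j).+1 < n)%N by lia.
  by rewrite negbK => /eqP <-; rewrite eq_j.
right; exists k, (nth 0%N w k); split=> //.
apply: (@eq_from_nth _ 0%N) => [|i]; rewrite ?size_ramp // sz_w => lt_in.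
rewrite nth_ramp //; case: ltnP => [/w_lt //|le_ki].
by have := w_cst (i - k)%N; rewrite subnKC // => -[].
Qed.

Lemma des_ramp n k a :
  (a < k)%N -> (k < n)%N -> des (ramp n k a) = (a < k.-1)%N.
Proof.
move=> lt_ak lt_kn; rewrite /des size_ramp.
have lt_k1 : (k.-1 < n - 1)%N by lia.
(* The only possible descent is from the last staircase letter [k.-1] to the first [a]. *)
have desE (i : 'I_(n - 1)) :
    (nth 0 (ramp n k a) i > nth 0 (ramp n k a) i.+1)%N
    = (i == Ordinal lt_k1) && (a < k.-1)%N.
  have lt_i := ltn_ord i; rewrite -val_eqE /= !nth_ramp; try lia.
  by do 2![case: ifP]; lia.
under eq_finset => i do rewrite desE.
case: ltnP => _; last by apply: eq_card0 => i; rewrite inE andbF.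
rewrite -[RHS](cards1 (Ordinal lt_k1)).
by apply: eq_card => i; rewrite !inE andbT.
Qed.

Lemma des_ramp_full n a : des (ramp n n a) = 0%N.
Proof.
rewrite /des size_ramp; apply: eq_card0 => i; rewrite !inE.
have lt_i := ltn_ord i.
by rewrite !nth_ramp; [do 2![case: ifP]; lia|lia|lia].
Qed.

(** Replaces the sum over tuples of bounded letters by one over an explicit list of plain words, via
    the injection [map val]. *)
Lemma catalan_gf_sum (X Y : rel nat) n (s : seq (seq nat)) :
  uniq s ->
  (forall w, (w \in s) = [&& size w == n, catalan w & avoids X Y w]) ->
  catalan_gf X Y n = \sum_(w <- s) 'X^(des w).
Proof.
move=> s_uniq mem_s; rewrite /catalan_gf -big_filter.
rewrite -(big_map (fun w : n.-tuple 'I_n => map val w) xpredT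
            (fun w => 'X^(des w))).
apply: perm_big; apply: uniq_perm => //.
  rewrite map_inj_uniq ?filter_uniq ?index_enum_uniq // => u v eq_uv.
  by apply/val_inj; apply: (inj_map val_inj).
move=> w; rewrite mem_s; apply/mapP/and3P => [[t]|[/eqP sz_w w_cat w_av]].
  by rewrite mem_filter => /andP[/andP[? ?] _] ->; rewrite size_map size_tuple.
have /allP w_lt := catalan_letters w_cat.
(* [insub] discards only letters that are at least [n], and a Catalan word of length [n] has
   none. *)
have w_val : map val (pmap (insub : nat -> option 'I_n) w) = w.
  rewrite pmap_filter; last exact: insubK.
  by apply/all_filterP/allP => a /w_lt; rewrite sz_w isSome_insub.
have sz_t : size (pmap (insub : nat -> option 'I_n) w) == n.
  by rewrite -(size_map val) w_val sz_w.
exists (Tuple sz_t); last by rewrite /= w_val.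
by rewrite mem_filter /= w_val w_cat w_av mem_index_enum.
Qed.

Lemma catalan_gf_geq_neqn0 : catalan_gf geq neqn 0 = 1.
Proof.
rewrite (catalan_gf_sum (ramps_uniq 0) (catalan_avoids_ramps 0)).
by rewrite big_seq1 des_ramp_full expr0.
Qed.

Lemma catalan_gf_geq_neqnS n :
  catalan_gf geq neqn n.+1 = n.+1%:R + 'C(n, 2)%:R * 'X.
Proof.
rewrite (catalan_gf_sum (ramps_uniq _) (catalan_avoids_ramps _)).
rewrite big_cons des_ramp_full expr0 /= big_allpairs_dep /=.
(* Among the [k] tail values, only [a = k.-1] creates no descent. *)
have inner k : (k \in iota 1 n) ->
    \sum_(a <- iota 0 k) 'X^(des (ramp n.+1 k a)) = 1 + k.-1%:R * 'X :> {poly int}.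
  rewrite mem_iota => /andP[]; case: k => // k _ le_kn.
  rewrite -[iota 0 _]/(index_iota 0 k.+1) big_nat_recr //= des_ramp //=.
  rewrite ltnn expr0 addrC; congr (_ + _).
  rewrite (eq_big_nat _ _ (F2 := fun=> 'X)) ?sumr_const_nat ?subn0 ?mulr_natl //.
  by move=> a /andP[_ lt_ak]; rewrite des_ramp /= ?lt_ak ?expr1 //; lia.
rewrite big_seq_cond; under eq_bigr => k /andP[hk _] do rewrite (inner k hk).
rewrite -big_seq_cond -[iota 1 n]/(iota 1 n.+1.-1) -subn1 big_add1 /=.
rewrite big_split /= sumr_const_nat subn0 -mulr_suml -natr_sum.
by rewrite -bin2_sum addrA -mulrS.
Qed.

Lemma fps_mul_Poly4 (R : comUnitRingType) (h : fps R) (a b c d : R) n :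
  fps_mul h (fps_of_poly (Poly [:: a; b; c; d])) n.+3
  = h n * d + h n.+1 * c + h n.+2 * b + h n.+3 * a.
Proof.
rewrite /fps_mul /fps_of_poly.
under eq_bigr do rewrite coef_Poly.
rewrite !big_ord_recr big1 /= => [|i _].
  have sub_n j : (j + n - n = j)%N by rewrite addnK.
  by rewrite add0r !subSS subnn (sub_n 3) (sub_n 2) (sub_n 1).
(* Terms with [i < n] use a coefficient of index above 3, where the default is 0. *)
rewrite nth_default ?mulr0 //=; have := ltn_ord i; lia.
Qed.

Theorem theorem3p26 :
  catalan_gf geq neqn =1
  fps_div
    (fps_of_poly (1 - 2 * x_ + 2 * x_ ^+ 2 - x_ ^+ 3 + x_ ^+ 3 * y_))
    (fps_of_poly ((1 - x_) ^+ 3)).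
Proof.
have -> : (1 - x_) ^+ 3 = Poly [:: 1; - 3; 3; - 1].
  by rewrite /= !cons_poly_def /x_ !rmorphN !rmorph_nat; ring.
have -> : 1 - 2 * x_ + 2 * x_ ^+ 2 - x_ ^+ 3 + x_ ^+ 3 * y_
   = Poly [:: 1; - 2; 2; 'X - 1].
  by rewrite /= !cons_poly_def /x_ /y_ !rmorphB !rmorphN !rmorph_nat; ring.
apply: fps_div_unique => [|[|[|[|n]]]].
- by rewrite /fps_of_poly coef_Poly unitr1.
- rewrite /fps_mul big_ord_recl big_ord0 /fps_of_poly !coef_Poly.
  by rewrite catalan_gf_geq_neqn0 mulr1 addr0.
- rewrite /fps_mul !big_ord_recl big_ord0 /fps_of_poly !coef_Poly [LHS]/=.
  by rewrite catalan_gf_geq_neqn0 catalan_gf_geq_neqnS bin_small //=; ring.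
- rewrite /fps_mul !big_ord_recr big_ord0 /fps_of_poly !coef_Poly [LHS]/= add0r.
  by rewrite catalan_gf_geq_neqn0 !catalan_gf_geq_neqnS !bin_small //=; ring.
rewrite fps_mul_Poly4 !catalan_gf_geq_neqnS /fps_of_poly coef_Poly.
(* Degree 3 still involves the constant coefficient 1, which the formula for positive lengths does
   not give. *)
case: n => [|n].
  by rewrite catalan_gf_geq_neqn0 binn !bin_small //=; ring.
(* From degree 4 on, the left side is a third difference of a quadratic in [n], hence 0; Pascal's
   rule makes this visible to [ring]. *)
rewrite catalan_gf_geq_neqnS [RHS]/= nth_nil !binS !bin1 !bin0 !natrD.
by ring.
Qed.
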